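(* Let $d>\sigma\ge2$, let $m$ be a symbol of order $\sigma$, $\Theta$ a collection of sectors and $\mathscr O$ a sector basis choice adapted to $\Theta$ and $m$ (see context). Fix any $\epsilon\in(0,1]$ and let $\epsilon_0>0$, the parameter in the definition of the norms $X_\theta,Y_\theta$, be sufficiently small depending on $\epsilon$. Then there is a constant $C$ (depending on $\epsilon_0$) such that for every interval $I\subseteq\mathbb R$, any two functions $h_+,h_-:I\times\mathbb R^d\to\mathbb C$ (extended by zero to $\mathbb R\times\mathbb R^d$) and any $\theta_+,\theta_-\in\Theta$ with $N_{\theta_+}\ge N_{\theta_-}$, each of the following four bounds holds: $$\|h_+h_-\|_{L^2_tL^2_x(I\times\mathbb R^d)}\le C\,N_{\theta_+}^{\epsilon}N_{\theta_+}^{-\frac{\sigma-1}2}N_{\theta_-}^{\frac\sigma4}\times\begin{cases}N_{\theta_-}^{\frac{2d-\sigma-2}4}\,\|h_+\|_{X_{\theta_+}(\mathbb R)}\|h_-\|_{X_{\theta_-}(\mathbb R)},\\ \|h_+\|_{Y_{\theta_+}(\mathbb R)}\|h_-\|_{Y_{\theta_-}(\mathbb R)},\\ \|h_+\|_{X_{\theta_+}(\mathbb R)}\|h_-\|_{Y_{\theta_-}(\mathbb R)},\\ \|h_+\|_{Y_{\theta_+}(\mathbb R)}\|h_-\|_{X_{\theta_-}(\mathbb R)}.\end{cases}$$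
   Context: **Symbols.** The symbol $m:\mathbb R^d\to\mathbb R$ is of order $\sigma$ if it is smooth and there are $C_{\max},C_{\mathcal L}\ge1$ such that for all $|\xi|\ge C_{\max}$: $|\partial^\alpha m(\xi)|\le C_{\mathcal L}|\xi|^{\sigma-|\alpha|}$ for $|\alpha|\in\{1,2,3\}$, $|\nabla m(\xi)|\ge C_{\mathcal L}^{-1}|\xi|^{\sigma-1}$, $|\det D^2m(\xi)|^{1/d}\ge C_{\mathcal L}^{-1}|\xi|^{\sigma-2}$. **Sectors.** Fix $\epsilon_\Theta\in(0,1]$ and a finite set $\mathscr S_\Theta\subset\mathbb S^{d-1}$, $\epsilon_\Theta$-separated, whose $\epsilon_\Theta$-balls cover $\mathbb S^{d-1}$. For $N\in(1+\epsilon_\Theta)^{\mathbb N}$ ($0\in\mathbb N$) and $\hat e\in\mathscr S_\Theta$ let $\theta_{N,\hat e}=\{\xi:1\le|\xi|/N\le(1+\epsilon_\Theta)^2,\ |\xi/|\xi|-\hat e|\le2\epsilon_\Theta\}$ if $N>1$ and $\theta_{1,\hat e}=\{|\xi|\le(1+\epsilon_\Theta)^2\}$. $\Theta$ is the family of all sectors indexed by $(N,\hat e)$; for $\theta=\theta_{N,\hat e}$ put $N_\theta=N$, and $c_\theta=N\hat e$ if $N>1$, $c_\theta=0$ if $N=1$. **Adapted basis choice.** A map $\mathscr O:\Theta\to O(d)$, $\theta\mapsto\mathscr O_\theta$, with finite range $\mathscr O(\Theta)$ such that, for some $C_{\mathscr O}\ge1$, for all $\theta$ with $N_\theta\ge2C_{\max}$,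 all $j\in\{1,\dots,d\}$ and $\xi\in\theta$: $C_{\mathscr O}^{-1}N_\theta^{\sigma-2}\le|\langle\mathscr O_\theta\hat e_j,D^2m(\xi)\mathscr O_\theta\hat e_j\rangle|\le C_{\mathscr O}N_\theta^{\sigma-2}$; $C_{\mathscr O}^{-1}N_\theta^{\sigma-1}\le|\langle\nabla m(\xi),\mathscr O_\theta\hat e_j\rangle|\le C_{\mathscr O}N_\theta^{\sigma-1}$; $|\langle\xi,\mathscr O_\theta\hat e_j\rangle|\ge C_{\mathscr O}^{-1}N_\theta$ ($\hat e_j$ standard basis). For $O\in O(d)$, $\mathscr J_\theta(O)=\{j\in\{1,\dots,d\}:|\langle\nabla m(c_\theta),O\hat e_j\rangle|\ge d^{-1/2}|\nabla m(c_\theta)|\}$. **Directional norms.** $S_j$ is the permutation matrix exchanging $\hat e_1$ and $\hat e_j$; for $O\in O(d)$, $$\|h\|_{L^{(a,b,c)}_{O,j}(I)}=\Big(\int_{\mathbb R}\Big(\int_I\Big(\int_{\mathbb R^{d-1}}|h(t,OS_j(x_1,x'))|^c\,dx'\Big)^{b/c}dt\Big)^{a/b}dx_1\Big)^{1/a}.$$ **Norms $X_\theta,Y_\theta$** (with small parameter $\epsilon_0\in(0,2^{-100})$). Both are sums of $$\|v\|_{L_t^{2/\epsilon_0}L_x^{2/(1-\epsilon_0)}(I\times\mathbb R^d)}+\|v\|_{L_t^{2/(1-\epsilon_0)}L_x^{\frac{2d}{d-2}\frac1{1-\epsilon_0}}(I\times\mathbb R^d)}$$ and directional terms. For $\|v\|_{X_\theta(I)}$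 these are $$\sum_{j=1}^d\Big(N_\theta^{-\frac\sigma4}\|v\|_{L^{(\frac2{1-\epsilon_0},\frac2{\epsilon_0},\frac2{1-\epsilon_0})}_{\mathscr O_\theta,j}(I)}+N_\theta^{-\frac{d-1}2}\|v\|_{L^{(\frac2{1-\epsilon_0},\frac2{\epsilon_0},\frac2{\epsilon_0})}_{\mathscr O_\theta,j}(I)}\Big)+\sum_{O\in\mathscr O(\Theta)}\sum_{j\in\mathscr J_\theta(O)}\Big(N_\theta^{\frac{\sigma-1}2}\|v\|_{L^{(\frac2{\epsilon_0},\frac2{1-\epsilon_0},\frac2{1-\epsilon_0})}_{O,j}(I)}+N_\theta^{-\frac{d-\sigma}2}\|v\|_{L^{(\frac2{\epsilon_0},\frac2{1-\epsilon_0},\frac2{\epsilon_0})}_{O,j}(I)}\Big),$$ and for $\|v\|_{Y_\theta(I)}$ they are the same expression with the weight $N_\theta^{-\frac{d-1}2}$ replaced by $N_\theta^{-\frac\sigma4}$ and the weight $N_\theta^{-\frac{d-\sigma}2}$ replaced by $N_\theta^{\frac{\sigma-1}2}$. *)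

(* Defs.v *)
From HB Require Import structures.
From mathcomp Require Import all_boot all_order all_algebra.
From mathcomp Require Import all_classical all_reals all_analysis.
From mathcomp Require Import complex.

Set Implicit Arguments.
Unset Strict Implicit.
Unset Printing Implicit Defensive.
Import Order.TTheory GRing.Theory Num.Theory.
Import numFieldNormedType.Exports.

Local Open Scope classical_set_scope.
Local Open Scope ring_scope.

(* Points of R^d are column vectors ['cV[R]_d].  The norm [`|x|] that the
   library puts on matrices is the sup norm, so the Euclidean structure is
   introduced separately. *)
Section Euclidean.
Context {R : realType} {d : nat}.
Implicit Types u v : 'cV[R]_d.

Definition dot u v : R := \sum_(i < d) u i 0 * v i 0.

Definition enorm u : R := Num.sqrt (dot u u).

Definition orthogonal_mx (O : 'M[R]_d) : Prop := O^T *m O = 1%:M.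

End Euclidean.

Section Derivatives.
Context {R : realType} {d : nat}.
Implicit Types (f : 'cV[R]_d -> R) (x : 'cV[R]_d).

Definition partial (i : 'I_d) f : 'cV[R]_d -> R :=
  fun x => 'D_(delta_mx i 0) f x.

Definition partials (s : seq 'I_d) f : 'cV[R]_d -> R := foldr partial f s.

Definition smooth f : Prop :=
  forall s : seq 'I_d, continuous (partials s f) /\
    forall (i : 'I_d) x, derivable (partials s f) x (delta_mx i 0).

Definition mpartial (alpha : {ffun 'I_d -> nat}) f : 'cV[R]_d -> R :=
  partials (flatten [seq nseq (alpha i) i | i <- enum 'I_d]) f.

Definition mdeg (alpha : {ffun 'I_d -> nat}) : nat := (\sum_(i < d) alpha i)%N.

Definition grad f x : 'cV[R]_d := \col_i partial i f x.

Definition hess f x : 'M[R]_d := \matrix_(i, j) partial i (partial j f) x.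

End Derivatives.

Section MeasurableColumn.
Context {disp : measure_display} {T : measurableType disp} {n : nat}.

Let coor : 'I_n -> 'cV[T]_n -> T := fun i x => x i 0.

Let col_set0 : g_sigma_preimage coor set0.
Proof. exact: sigma_algebra0. Qed.

Let col_setC A : g_sigma_preimage coor A -> g_sigma_preimage coor (~` A).
Proof. exact: sigma_algebraC. Qed.

Let col_bigcup (F : _^nat) : (forall i, g_sigma_preimage coor (F i)) ->
  g_sigma_preimage coor (\bigcup_i (F i)).
Proof. exact: sigma_algebra_bigcup. Qed.

HB.instance Definition _ := @isMeasurable.Build (measure_tuple_display disp)
  'cV[T]_n (g_sigma_preimage coor) col_set0 col_setC col_bigcup.

Lemma measurable_coor (i : 'I_n) :
  measurable_fun [set: 'cV[T]_n] (fun x : 'cV[T]_n => x i 0).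
Proof.
move=> _ Y mY; rewrite setTI; apply: sub_sigma_algebra => /=.
rewrite -bigcup_seq/=; exists i => /=; first by rewrite mem_index_enum.
by exists Y => //; rewrite setTI.
Qed.

Lemma measurable_fun_coorP d' (T' : measurableType d') (f : T' -> 'cV[T]_n) :
  (forall i, measurable_fun [set: T'] (fun x => f x i 0)) ->
  measurable_fun [set: T'] f.
Proof.
move=> mf; apply: (@measurability _ _ _ _ setT f
  (\big[setU/set0]_(i < n) preimage_set_system setT (coor i) measurable)) => //.
move=> _ [B + <-]; rewrite -bigcup_seq => -[i _ [A mA <-]].
by have := mf i measurableT A mA; rewrite !setTI.
Qed.

End MeasurableColumn.


Section LebesgueColumn.
Context {R : realType}.

(* the point (x_1, x') of R^(n+1) *)
Definition vcons n (p : R * 'cV[R]_n) : 'cV[R]_n.+1 :=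
  col_mx (p.1%:M : 'cV[R]_1) p.2.

Definition vuncons n (v : 'cV[R]_n.+1) : R * 'cV[R]_n :=
  (v ord0 0, \col_i v (lift ord0 i) 0).

Lemma vcons0 n (p : R * 'cV[R]_n) : vcons p ord0 0 = p.1.
Proof.
rewrite /vcons (_ : ord0 = lshift n (ord0 : 'I_1)); last exact/val_inj.
by rewrite (@col_mxEu _ 1 n 1) mxE eqxx mulr1n.
Qed.

Lemma vconsS n (p : R * 'cV[R]_n) i : vcons p (lift ord0 i) 0 = p.2 i 0.
Proof.
rewrite /vcons (_ : lift ord0 i = rshift 1 i); last exact/val_inj.
by rewrite (@col_mxEd _ 1 n 1).
Qed.

Lemma vconsK n : cancel (@vcons n) (@vuncons n).
Proof.
move=> p; rewrite /vuncons vcons0 [RHS]surjective_pairing; congr pair.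
by apply/colP => i; rewrite mxE vconsS.
Qed.

Lemma measurable_vcons n : measurable_fun setT (@vcons n).
Proof.
apply: (@measurable_fun_coorP _ R) => i; case: (unliftP ord0 i) => [j ->|->].
  under eq_fun do rewrite vconsS.
  exact: (measurableT_comp (@measurable_coor _ R n j) measurable_snd).
under eq_fun do rewrite vcons0.
exact: measurable_fst.
Qed.

Lemma measurable_vuncons n : measurable_fun setT (@vuncons n).
Proof.
apply/measurable_fun_pairP; split; first exact: measurable_coor.
apply: (@measurable_fun_coorP _ R) => i; rewrite /comp/=.
under eq_fun do rewrite mxE.
exact: measurable_coor.
Qed.

Section Step.
Context {n : nat} (mu : {sigma_finite_measure set 'cV[R]_n -> \bar R}).

Definition lebesgue_cons : set 'cV[R]_n.+1 -> \bar R :=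
  pushforward ((@lebesgue_measure R) \x mu)%E (@vcons n).

Let lebesgue_cons0 : lebesgue_cons set0 = 0%E.
Proof. by rewrite /lebesgue_cons /pushforward preimage_set0 measure0. Qed.

Let lebesgue_cons_ge0 A : (0 <= lebesgue_cons A)%E.
Proof. by rewrite /lebesgue_cons /pushforward measure_ge0. Qed.

Let lebesgue_cons_sigma_additive : semi_sigma_additive lebesgue_cons.
Proof.
move=> F mF tF mUF; rewrite /lebesgue_cons /pushforward preimage_bigcup.
have mcons A : measurable A -> measurable (@vcons n @^-1` A).
  by move=> mA; rewrite -[X in measurable X]setTI; exact: measurable_vcons.
apply: measure_semi_sigma_additive.
- by move=> k; exact: mcons.
- apply/trivIsetP => /= a b _ _ ab; rewrite -preimage_setI.
  by move/trivIsetP : tF => /(_ _ _ _ _ ab) ->//; rewrite preimage_set0.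
- by rewrite -preimage_bigcup; exact: mcons.
Qed.

HB.instance Definition _ := isMeasure.Build _ _ _ lebesgue_cons
  lebesgue_cons0 lebesgue_cons_ge0 lebesgue_cons_sigma_additive.

Let lebesgue_cons_sigma_finite : sigma_finite setT lebesgue_cons.
Proof.
have /sigma_finiteP[F [TF ndF Foo]] := sigma_finiteT (@lebesgue_measure R).
have /sigma_finiteP[G [TG ndG Goo]] := sigma_finiteT mu.
exists (fun k => @vuncons n @^-1` (F k `*` G k)).
  rewrite -preimage_bigcup -[LHS](preimage_setT (@vuncons n)).
  congr (_ @^-1` _); rewrite -setXTT TF TG predeqE => -[x y]; split.
    move=> [/= [a _ Fax] [b _ Gby]]; exists (maxn a b) => //; split.
    - by move: x Fax; exact/subsetPset/ndF/leq_maxl.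
    - by move: y Gby; exact/subsetPset/ndG/leq_maxr.
  by move=> [a _ []/= ? ?]; split; exists a.
move=> k; have [? ?] := Foo k; have [? ?] := Goo k.
have mFG : measurable (F k `*` G k) by exact: measurableX.
split.
  by rewrite -[X in measurable X]setTI; exact: measurable_vuncons.
rewrite /lebesgue_cons /pushforward (_ : _ @^-1` _ = F k `*` G k).
  by rewrite product_measure1E// lte_mul_pinfty// ge0_fin_numE.
by rewrite -comp_preimage (_ : _ \o _ = id)//; apply/funext; exact: vconsK.
Qed.

HB.instance Definition _ := Measure_isSigmaFinite.Build _ _ _ lebesgue_cons
  lebesgue_cons_sigma_finite.

End Step.

(* The library has no Lebesgue measure on R^n: it is built here as the iterated
   product of the one-dimensional one. *)
Fixpoint lebesgue_col n : {sigma_finite_measure set 'cV[R]_n -> \bar R} :=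
  match n with
  | 0 => @dirac _ _ (0 : 'cV[R]_0) R
  | n.+1 => lebesgue_cons (lebesgue_col n)
  end.

End LebesgueColumn.

Section Symbol.
Context {R : realType} {d : nat}.

Record symbol_of_order (sigma Cmax CL : R) (m : 'cV[R]_d -> R) : Prop := {
  symbol_smooth : smooth m;
  symbol_Cmax : 1 <= Cmax;
  symbol_CL : 1 <= CL;
  symbol_upper : forall xi (alpha : {ffun 'I_d -> nat}),
    Cmax <= enorm xi -> (1 <= mdeg alpha <= 3)%N ->
    `|mpartial alpha m xi| <= CL * enorm xi `^ (sigma - (mdeg alpha)%:R);
  symbol_grad : forall xi, Cmax <= enorm xi ->
    CL^-1 * enorm xi `^ (sigma - 1) <= enorm (grad m xi);
  symbol_hess : forall xi, Cmax <= enorm xi ->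
    CL^-1 * enorm xi `^ (sigma - 2) <= `|\det (hess m xi)| `^ d%:R^-1
}.

End Symbol.

Section Sectors.
Context {R : realType} {d : nat}.
Implicit Types (epsT : R) (S : set 'cV[R]_d).

Record sector_directions epsT S : Prop := {
  directions_finite : finite_set S;
  directions_sphere : forall e, S e -> enorm e = 1;
  directions_separated :
    forall e e', S e -> S e' -> e != e' -> epsT <= enorm (e - e');
  directions_cover : forall xi, enorm xi = 1 ->
    exists2 e, S e & enorm (xi - e) <= epsT
}.

(* The index (k, e) stands for the sector theta_{N, e} with
   N = (1 + epsT)^k; as epsT > 0, N determines k. *)
Definition sector_index : Type := (nat * 'cV[R]_d)%type.

Definition sectors S : set sector_index := [set th | S th.2].

Definition freq epsT (th : sector_index) : R := (1 + epsT) ^+ th.1.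

Definition center epsT (th : sector_index) : 'cV[R]_d :=
  if 1 < freq epsT th then freq epsT th *: th.2 else 0.

Definition sector epsT (th : sector_index) : set 'cV[R]_d :=
  if 1 < freq epsT th then
    [set xi | 1 <= enorm xi / freq epsT th <= (1 + epsT) ^+ 2 /\
              enorm ((enorm xi)^-1 *: xi - th.2) <= 2 * epsT]
  else [set xi | enorm xi <= (1 + epsT) ^+ 2].

(* [col j (Oc th)] is the image of the j-th standard basis vector *)
Record adapted_basis_choice (sigma Cmax epsT : R) S (m : 'cV[R]_d -> R)
    (Oc : sector_index -> 'M[R]_d) : Prop := {
  basis_orthogonal : forall th, sectors S th -> orthogonal_mx (Oc th);
  basis_finite : finite_set (Oc @` sectors S);
  basis_adapted : exists2 CO : R, 1 <= CO &
    forall th, sectors S th -> 2 * Cmax <= freq epsT th ->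
    forall (j : 'I_d) xi, sector epsT th xi ->
    [/\ CO^-1 * freq epsT th `^ (sigma - 2)
          <= `|dot (col j (Oc th)) (hess m xi *m col j (Oc th))|
          <= CO * freq epsT th `^ (sigma - 2),
        CO^-1 * freq epsT th `^ (sigma - 1)
          <= `|dot (grad m xi) (col j (Oc th))|
          <= CO * freq epsT th `^ (sigma - 1) &
        CO^-1 * freq epsT th <= `|dot xi (col j (Oc th))| ]
}.

Definition good_directions epsT (m : 'cV[R]_d -> R) (th : sector_index)
    (O : 'M[R]_d) : {set 'I_d} :=
  [set j : 'I_d | `|dot (grad m (center epsT th)) (col j O)|
                    >= (Num.sqrt d%:R)^-1 * enorm (grad m (center epsT th))].

End Sectors.

(* Functions of (t, x) in R * R^d, with d = n.+1 *)
Section Norms.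
Context {R : realType} {n : nat}.
Local Notation d := n.+1.
Local Notation leb := (@lebesgue_measure R).
Implicit Types (h v : R * 'cV[R]_d -> R[i]) (I : set R).

Definition cmeasurable_fun (D : set (R * 'cV[R]_d)) h : Prop :=
  measurable_fun D (fun z => complex.Re (h z)) /\
  measurable_fun D (fun z => complex.Im (h z)).

Definition zero_ext I h : R * 'cV[R]_d -> R[i] :=
  patch (fun=> 0) (I `*` setT) h.

Local Open Scope ereal_scope.

Definition mixed_norm (q r : R) I h : \bar R :=
  (\int[leb]_(t in I)
    (\int[lebesgue_col d]_x (Normc.normc (h (t, x)) `^ r)%:E) `^ (q / r))
  `^ q^-1.

Definition directional_norm (a b c : R) (O : 'M[R]_d) (j : 'I_d) I h : \bar R :=
  (\int[leb]_x1
    (\int[leb]_(t in I)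
      (\int[lebesgue_col n]_x'
        (Normc.normc (h (t, O *m tperm_mx ord0 j *m vcons (x1, x')))
           `^ c)%:E) `^ (b / c)) `^ (a / b)) `^ a^-1.

Section SectorNorms.
Context (sigma epsT eps0 : R) (S : set 'cV[R]_d) (m : 'cV[R]_d -> R).
Context (Oc : @sector_index R d -> 'M[R]_d).
Implicit Type th : @sector_index R d.

(* common shape of the two norms, up to the weights w and w' *)
Definition sector_norm (w w' : R) th I v : \bar R :=
  let N := freq epsT th in
  let big := (2 / eps0)%R in
  let small := (2 / (1 - eps0))%R in
  mixed_norm big small I v
  + mixed_norm small (2 * d%:R / (d%:R - 2) * (1 - eps0)^-1)%R I v
  + \sum_(j < d)
      ((N `^ (- (sigma / 4)))%:E
         * directional_norm small big small (Oc th) j I v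
       + w%:E * directional_norm small big big (Oc th) j I v)
  + \sum_(O \in Oc @` sectors S) \sum_(j in good_directions epsT m th O)
      ((N `^ ((sigma - 1) / 2))%:E * directional_norm big small small O j I v
       + w'%:E * directional_norm big small big O j I v).

Definition Xnorm th I v : \bar R :=
  sector_norm (freq epsT th `^ (- ((d%:R - 1) / 2)))
              (freq epsT th `^ (- ((d%:R - sigma) / 2))) th I v.

Definition Ynorm th I v : \bar R :=
  sector_norm (freq epsT th `^ (- (sigma / 4)))
              (freq epsT th `^ ((sigma - 1) / 2)) th I v.

End SectorNorms.
End Norms.

(* Main.v *)
Require Import Defs.
From HB Require Import structures.
From mathcomp Require Import all_boot all_order all_algebra.
From mathcomp Require Import all_classical all_reals all_analysis.
From mathcomp Require Import measurable_realfun complex ring.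
Import Order.TTheory GRing.Theory Num.Theory.
Import numFieldNormedType.Exports.
Set Implicit Arguments.
Unset Strict Implicit.
Unset Printing Implicit Defensive.
Local Open Scope classical_set_scope.
Local Open Scope ring_scope.

(* Put [O = O_{theta_-}].  As [O] is orthogonal, some [j] lies in
   [J_{theta_+}(O)], so both norms control directional norms along the same
   axis [O e_j].  Lebesgue measure is rotation invariant, so the L^2 norm of
   [h_+ h_-] may be computed in the coordinates [x = O S_j (x_1, x')], where
   Hoelder's inequality is applied in [x'], [t] and [x_1] in turn with exponents
   [2/eps0] and [2/(1 - eps0)], whose inverses add up to [1/2]: in [x_1] the
   exponent [2/eps0] goes to [h_+] and in [t] to [h_-].  In [x'] it goes to
   [h_-] in the first three bounds and to [h_+] in the last one.  The weights
   then match with [C = 1]. *)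

(** * Hoelder's inequality for nonnegative extended-real functions *)

Lemma measurable_fun_poweR d (T : measurableType d) (R : realType)
    (f : T -> \bar R) (r : R) :
  measurable_fun setT f -> measurable_fun setT (fun x => f x `^ r)%E.
Proof. exact: measurableT_comp (measurable_poweR r). Qed.

Section Hoelder.
Context d (T : measurableType d) (R : realType).
Context (mu : {measure set T -> \bar R}).
Local Open Scope ereal_scope.
Implicit Types u v : T -> \bar R.

(** The inner integrals of a mixed norm may be infinite, hence values in [\bar R]. Away from the
    degenerate cases both functions are finite almost everywhere, and real-valued Hoelder applies to
    [fine \o u] and [fine \o v]. *)
Lemma ge0_hoelder u v (p q : R) :
  measurable_fun setT u -> measurable_fun setT v ->
  (forall x, 0 <= u x) -> (forall x, 0 <= v x) ->
  (0 < p)%R -> (0 < q)%R -> (p^-1 + q^-1 = 1)%R ->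
  \int[mu]_x (u x * v x) <=
  (\int[mu]_x u x `^ p) `^ p^-1 * (\int[mu]_x v x `^ q) `^ q^-1.
Proof.
move=> mu_ mv u0 v0 p0 q0 pq.
have LE w r : (forall x, 0 <= w x) ->
    (\int[mu]_x w x `^ r) `^ r^-1 = Lnorm mu r%:E w.
  move=> w0; rewrite unlock; congr (_ `^ _).
  by apply: eq_integral => x _; rewrite gee0_abs.
have null w w' r : measurable_fun setT w -> measurable_fun setT w' ->
    (0 < r)%R -> Lnorm mu r%:E w = 0 -> \int[mu]_x (w x * w' x) = 0.
  move=> mw mw' r0 w0; rewrite (ae_eq_integral (cst 0)) ?integral0//.
  - exact: emeasurable_funM.
  - have := @Lnorm_eq0_eq0 _ _ _ mu w r%:E mw.
    rewrite lte_fin => /(_ r0 w0).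
    by apply: filterS => x /(_ I) -> _; rewrite mul0e.
rewrite !LE//.
(* The zero cases go first, since [0 * +oo] is [0]. Once both norms are positive, an infinite one
   makes the right-hand side [+oo]. *)
have [u00|uN0] := eqVneq (Lnorm mu p%:E u) 0.
  by rewrite (null _ _ p)// mule_ge0// Lnorm_ge0.
have [v00|vN0] := eqVneq (Lnorm mu q%:E v) 0.
  under eq_integral do rewrite muleC.
  by rewrite (null _ _ q)// mule_ge0// Lnorm_ge0.
have {uN0}u_gt0 : 0 < Lnorm mu p%:E u by rewrite lt0e uN0 Lnorm_ge0.
have {vN0}v_gt0 : 0 < Lnorm mu q%:E v by rewrite lt0e vN0 Lnorm_ge0.
have [uoo|uoo] := eqVneq (Lnorm mu p%:E u) +oo.
  by rewrite uoo gt0_mulye// leey.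
have [voo|voo] := eqVneq (Lnorm mu q%:E v) +oo.
  by rewrite voo gt0_muley// leey.
have fin w r : measurable_fun setT w -> (forall x, 0 <= w x) -> (0 < r)%R ->
    Lnorm mu r%:E w != +oo -> {ae mu, forall x, w x \is a fin_num}.
  move=> mw w0 r0; rewrite -LE// => woo.
  have iw : mu.-integrable setT (fun x => w x `^ r).
    apply/integrableP; split.
      exact: measurable_fun_poweR.
    under eq_integral do rewrite gee0_abs ?poweR_ge0//.
    rewrite ltey; apply: contra woo => /eqP ->.
    by rewrite poweRyr// invr_neq0// gt_eqF.
  apply: filterS (integrable_ae measurableT iw) => x /(_ I) wr.
  rewrite ge0_fin_numE// ltey; apply/negP => /eqP wx.
  by move: wr; rewrite wx poweRyr// gt_eqF.
have fineL w r : measurable_fun setT w -> (forall x, 0 <= w x) ->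
    {ae mu, forall x, w x \is a fin_num} ->
    Lnorm mu r%:E w = Lnorm mu r%:E (EFin \o (fine \o w)).
  move=> mw w0 fw; rewrite unlock; congr (_ `^ _); apply: ae_eq_integral => //.
  - by apply: measurable_fun_poweR; exact: measurableT_comp.
  - apply: measurable_fun_poweR.
    apply: measurableT_comp => //; apply/measurable_EFinP.
    exact: measurableT_comp.
  - by apply: filterS fw => x wx _; congr (`|_| `^ _); rewrite /= fineK.
have fu := fin _ _ mu_ u0 p0 uoo.
have fv := fin _ _ mv v0 q0 voo.
rewrite (fineL u)// (fineL v)//.
apply: le_trans; last first.
  by apply: hoelder => //; exact: measurableT_comp.
rewrite Lnorm1 le_eqVlt; apply/orP; left; apply/eqP.
apply: ae_eq_integral => //.
- exact: emeasurable_funM.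
- do 2 apply: measurableT_comp => //.
  by apply: measurable_funM; exact: measurableT_comp.
- apply: filterS2 fu fv => x ux vx _ /=.
  by rewrite ger0_norm ?mulr_ge0 ?fine_ge0// EFinM !fineK.
Qed.

Lemma ge0_hoelder2 u v (p q r s : R) :
  measurable_fun setT u -> measurable_fun setT v ->
  (forall x, 0 <= u x) -> (forall x, 0 <= v x) ->
  (0 < p)%R -> (0 < q)%R -> (p^-1 + q^-1 = 2^-1)%R ->
  \int[mu]_x (u x `^ (2 / r) * v x `^ (2 / s)) <=
  (\int[mu]_x u x `^ (p / r)) `^ (2 / p) *
  (\int[mu]_x v x `^ (q / s)) `^ (2 / q).
Proof.
move=> mu_ mv u0 v0 p0 q0 pq.
have E w (a b : R) :
    \int[mu]_x w x `^ (a / b) = \int[mu]_x (w x `^ (2 / b)) `^ (a / 2).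
  apply: eq_integral => x _; rewrite -poweRrM; congr (_ `^ _).
  by rewrite mulrCA mulrAC divff ?mul1r.
rewrite (E u) (E v) -(invf_div p) -(invf_div q).
apply: ge0_hoelder.
- exact: measurable_fun_poweR.
- exact: measurable_fun_poweR.
- by move=> x; exact: poweR_ge0.
- by move=> x; exact: poweR_ge0.
- by rewrite divr_gt0.
- by rewrite divr_gt0.
- by rewrite !invf_div -mulrDr pq divff.
Qed.

End Hoelder.

(** * Translation and rotation invariance of Lebesgue measure on column vectors *)

Section LebesgueColumnInvariance.
Context {R : realType}.
Local Notation leb := (@lebesgue_measure R).
Local Open Scope ereal_scope.

Lemma ge0_integral_col n (f : 'cV[R]_n.+1 -> \bar R) :
  measurable_fun setT f -> (forall x, 0 <= f x) ->
  \int[lebesgue_col n.+1]_x f x =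
  \int[leb]_x1 \int[lebesgue_col n]_x' f (vcons (x1, x')).
Proof.
move=> mf f0.
have mv : measurable_fun setT (@vcons R n : measurableTypeR R * 'cV[R]_n -> _).
  exact: measurable_vcons.
have mfc := measurableT_comp mf mv.
transitivity (\int[leb \x lebesgue_col n]_z (f \o @vcons R n) z).
  have := ge0_integral_pushforward mv
    (leb \x lebesgue_col n) measurableT mf.
  by rewrite preimage_setT; apply => x _; exact: f0.
rewrite fubini_tonelli1// => x; exact: f0.
Qed.

(** The image of Lebesgue measure under a translation gives each half-open interval its length, so
    by uniqueness it is Lebesgue measure. *)
Lemma ge0_integral_shift (f : R -> \bar R) (a : R) :
  measurable_fun setT f -> (forall x, 0 <= f x) ->
  \int[leb]_x f (x + a)%R = \int[leb]_x f x.
Proof.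
move=> mf f0.
pose s (x : measurableTypeR R) : measurableTypeR R := (x + a)%R.
have ms : measurable_fun setT s by exact: measurable_funD.
pose S : {mfun measurableTypeR R >-> measurableTypeR R} :=
  HB.pack s (isMeasurableFun.Build _ _ _ _ s ms).
transitivity (\int[pushforward leb S]_x f x).
  by rewrite ge0_integral_pushforward// preimage_setT.
apply: eq_measure_integral => //= A mA _.
apply/esym/lebesgue_measure_unique => //= _ [[b c]] _ <-.
rewrite /pushforward (_ : _ @^-1` _ = `](b - a)%R, (c - a)%R]%classic).
  by rewrite !lebesgue_measure_itv/= !lte_fin ltrD2r -!EFinD opprB addrA subrK.
by apply/seteqP; split=> x /=; rewrite /s !in_itv/= ltrBlDr lerBrDr.
Qed.

Lemma vconsD n (x1 y1 : R) (x y : 'cV[R]_n) :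
  (vcons (x1, x) + vcons (y1, y) = vcons (x1 + y1, x + y))%R.
Proof.
apply/colP => i; case: (unliftP ord0 i) => [j ->|->].
  by rewrite mxE !vconsS mxE.
by rewrite mxE !vcons0.
Qed.

Lemma vcons_surj n (x : 'cV[R]_n.+1) : exists p, x = vcons p.
Proof.
exists (vuncons x); apply/colP => i; case: (unliftP ord0 i) => [j ->|->].
  by rewrite vconsS mxE.
by rewrite vcons0.
Qed.

Lemma measurable_affine_pair n (A : 'M[R]_n) :
  measurable_fun setT (fun z : 'cV[R]_n * 'cV[R]_n => A *m z.1 + z.2)%R.
Proof.
apply: (@measurable_fun_coorP _ R) => i; under eq_fun do rewrite !mxE.
apply: measurable_funD.
  apply: measurable_sum => j; apply: measurable_funM => //.
  exact: (measurableT_comp (@measurable_coor _ R n j) measurable_fst).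
exact: (measurableT_comp (@measurable_coor _ R n i) measurable_snd).
Qed.

Lemma measurable_affine n (A : 'M[R]_n) a :
  measurable_fun setT (fun x : 'cV[R]_n => A *m x + a)%R.
Proof. exact: (measurable_fun_pair1 a (measurable_affine_pair A)). Qed.

(** Induction on the dimension: Tonelli splits off the first coordinate, which is shifted by the
    one-dimensional case, and the induction hypothesis shifts the others. *)
Lemma ge0_integral_col_shift n (f : 'cV[R]_n -> \bar R) (a : 'cV[R]_n) :
  measurable_fun setT f -> (forall x, 0 <= f x) ->
  \int[lebesgue_col n]_x f (x + a)%R = \int[lebesgue_col n]_x f x.
Proof.
elim: n => [|n IH] in f a *.
  by move=> mf f0; apply: eq_integral => x _; congr f; apply/colP; case.
move=> mf f0; have [[a1 a'] ->] := vcons_surj a.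
have mfv : measurable_fun setT (f \o @vcons R n).
  exact: measurableT_comp mf (@measurable_vcons R n).
rewrite ge0_integral_col//; last first.
  have := measurable_affine 1%:M (vcons (a1, a')).
  by under eq_fun do rewrite mul1mx; exact: measurableT_comp.
rewrite (ge0_integral_col mf f0).
pose F x1 := \int[lebesgue_col n]_x' f (vcons (x1, x')).
rewrite -(@ge0_integral_shift F a1); first last.
- by move=> x; exact: integral_ge0.
- apply: (measurable_fun_fubini_tonelli_F (f \o @vcons R n)) => // x.
  exact: f0.
apply: eq_integral => x1 _.
under eq_integral do rewrite vconsD.
apply: (IH (fun x' => f (vcons (x1 + a1, x')%R)) a') => //.
exact: (measurable_fun_pair2 _ mfv).
Qed.

Lemma measurable_dot n :
  measurable_fun setT (fun x : 'cV[R]_n => dot x x).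
Proof.
apply: measurable_sum => i.
by apply: measurable_funM; exact: measurable_coor.
Qed.

Lemma dot_vcons n (x1 : R) (x : 'cV[R]_n) :
  dot (vcons (x1, x)) (vcons (x1, x)) = (x1 ^+ 2 + dot x x)%R.
Proof.
rewrite /dot big_ord_recl !vcons0 expr2; congr (_ + _)%R.
by apply: eq_bigr => i _; rewrite !vconsS.
Qed.

Definition gauss_col n (x : 'cV[R]_n) : \bar R := (expR (- dot x x))%:E.

Lemma gauss_col_ge0 n (x : 'cV[R]_n) : 0 <= gauss_col x.
Proof. by rewrite lee_fin expR_ge0. Qed.

Lemma measurable_gauss_col n : measurable_fun setT (@gauss_col n).
Proof.
apply/measurable_EFinP; apply: measurableT_comp => //.
by apply: measurableT_comp => //; exact: measurable_dot.
Qed.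

(** The squared norm is additive along [vcons], so the Gaussian is a product of one-dimensional
    ones. What matters later is that the value is finite and nonzero. *)
Lemma integral_gauss_col n :
  \int[lebesgue_col n]_x gauss_col x = (Num.sqrt pi ^+ n)%:E.
Proof.
elim: n => [|n IH].
  rewrite integral_dirac//; last exact: measurable_gauss_col.
  rewrite diracT mul1e /gauss_col /dot big_ord0 oppr0.
  by rewrite expR0 expr0.
rewrite ge0_integral_col; [|exact: measurable_gauss_col|exact: gauss_col_ge0].
transitivity (\int[leb]_x1 ((gauss_fun x1)%:E * (Num.sqrt pi ^+ n)%:E)).
  apply: eq_integral => x1 _; rewrite -IH -ge0_integralZl//.
  - apply: eq_integral => x _.
    by rewrite /gauss_col dot_vcons opprD expRD EFinM.
  - exact: measurable_gauss_col.
  - by move=> x _; exact: gauss_col_ge0.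
  - by rewrite lee_fin gauss_fun_ge0.
have mgauss : measurable_fun setT (fun x : R => (@gauss_fun R x)%:E).
  by apply/measurable_EFinP; exact: measurable_gauss_fun.
rewrite ge0_integralZr//.
- by rewrite integralT_gauss -EFinM -exprS.
- by move=> x _; rewrite lee_fin gauss_fun_ge0.
Qed.

Lemma dot_orthogonal n (A : 'M[R]_n) (x : 'cV[R]_n) :
  orthogonal_mx A -> dot (A *m x) (A *m x) = dot x x.
Proof.
have dotE (y : 'cV[R]_n) : dot y y = (y^T *m y)%R 0%R 0%R.
  by rewrite mxE; apply: eq_bigr => i _; rewrite mxE.
by move=> AA; rewrite !dotE trmx_mul -mulmxA (mulmxA A^T) AA mul1mx.
Qed.

(* Weil's uniqueness argument for Haar measure: for [f >= 0] and the rotation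
   invariant [g = gauss_col], translation invariance and Tonelli's theorem give
   [(\int f \o A) * \int g = \int\int f (A x + y) g y
    = \int\int f y g (y - A x) = \int f * \int g]. *)
Lemma ge0_integral_col_orthogonal n (A : 'M[R]_n) (f : 'cV[R]_n -> \bar R) :
  orthogonal_mx A -> measurable_fun setT f -> (forall x, 0 <= f x) ->
  \int[lebesgue_col n]_x f (A *m x)%R = \int[lebesgue_col n]_x f x.
Proof.
move=> AA mf f0; have AA' := mulmx1C AA.
pose mu := @lebesgue_col R n; pose g := @gauss_col n.
have mg := @measurable_gauss_col n; have g0 := @gauss_col_ge0 n.
have mfA : measurable_fun setT (fun x => f (A *m x)%R).
  have := measurable_affine A 0%R.
  by under eq_fun do rewrite addr0; exact: measurableT_comp.
(* [A] maps [x - A^T *m y] to [-(y - A *m x)], and the Gaussian is even and invariant under [A]. *)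
have gE (x y : 'cV[R]_n) : g (y - A *m x)%R = g (x - A^T *m y)%R.
  rewrite /g /gauss_col -(dot_orthogonal (x - A^T *m y)%R AA) mulmxBr mulmxA.
  rewrite AA' mul1mx /dot; congr (expR (- _))%:E.
  by apply: eq_bigr => i _; rewrite -(opprB (A *m x)%R y) !mxE mulrNN.
pose F1 (z : 'cV[R]_n * 'cV[R]_n) := f (A *m z.1 + z.2)%R * g z.2.
pose F2 (z : 'cV[R]_n * 'cV[R]_n) := f z.2 * g (z.2 - A *m z.1)%R.
have mF1 : measurable_fun setT F1.
  apply: emeasurable_funM.
    exact: measurableT_comp (measurable_affine_pair A).
  exact: measurableT_comp mg measurable_snd.
have mF2 : measurable_fun setT F2.
  apply: emeasurable_funM; first exact: measurableT_comp mf measurable_snd.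
  apply: measurableT_comp mg _.
  have := measurable_affine_pair (- A)%R.
  by under eq_fun do rewrite mulNmx addrC.
have F10 z : 0 <= F1 z by rewrite mule_ge0.
have F20 z : 0 <= F2 z by rewrite mule_ge0.
have E : (\int[mu]_x f (A *m x)%R) * (Num.sqrt pi ^+ n)%:E =
    (\int[mu]_x f x) * (Num.sqrt pi ^+ n)%:E.
  rewrite -integral_gauss_col.
  transitivity (\int[mu]_y \int[mu]_x F1 (x, y)).
    rewrite -ge0_integralZl//; last exact: integral_ge0.
    (* Shifting [x] by [A^T *m y] turns [A *m x] into [A *m x + y]. *)
    apply: eq_integral => y _; rewrite -(ge0_integral_col_shift (A^T *m y)%R)//.
    under eq_integral do rewrite mulmxDr mulmxA AA' mul1mx.
    rewrite -ge0_integralZr//.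
    exact: measurableT_comp mf (measurable_affine A y).
  rewrite -(fubini_tonelli F1)//.
  transitivity (\int[mu]_x \int[mu]_y F2 (x, y)).
    apply: eq_integral => x _.
    rewrite -(ge0_integral_col_shift (- (A *m x))%R)//.
      by apply: eq_integral => y _; rewrite /F1 /F2/= addrC subrK.
    exact: (measurable_fun_pair2 _ mF1).
  rewrite (fubini_tonelli F2)// -ge0_integralZr//; last exact: integral_ge0.
  apply: eq_integral => y _; rewrite /F2/=.
  under eq_integral do rewrite gE.
  rewrite -(@ge0_integral_col_shift _ (@gauss_col n) (- (A^T *m y))%R)//.
  rewrite ge0_integralZl//.
  have := measurable_affine 1%:M (- (A^T *m y))%R.
  by under eq_fun do rewrite mul1mx; exact: measurableT_comp.
have c0 : (Num.sqrt pi ^+ n != 0 :> R)%R.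
  by rewrite expf_neq0// gt_eqF// sqrtr_gt0 pi_gt0.
(* The integrals of [f] may be infinite, so the Gaussian mass is cancelled by multiplying with its
   inverse. *)
have := congr1 (fun e => e * ((Num.sqrt pi ^+ n)^-1)%:E) E.
by rewrite -!muleA -EFinM divff// !mule1.
Qed.

End LebesgueColumnInvariance.

(** * Hoelder's inequality for triple mixed norms *)

Section MixedHoelder.
Context d1 d2 d3 (T1 : measurableType d1) (T2 : measurableType d2)
  (T3 : measurableType d3) (R : realType).
Context (m1 : {measure set T1 -> \bar R})
  (m2 : {sigma_finite_measure set T2 -> \bar R})
  (m3 : {sigma_finite_measure set T3 -> \bar R}).
Local Open Scope ereal_scope.

(** Abstract directional norm: [x], [t], [y] stand for [x_1], time and the transverse variable [x'],
    listed from the outermost integral to the innermost. *)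
Definition mixed_norm3 (a b c : R) (h : T1 * T2 * T3 -> R) : \bar R :=
  (\int[m1]_x (\int[m2]_t (\int[m3]_y (h (x, t, y) `^ c)%:E) `^ (b / c))
     `^ (a / b)) `^ a^-1.

(** The L^2 norm is an iterated integral of the square, so [ge0_hoelder2] can be applied from the
    inside out, each layer with its own pair of exponents. *)
Lemma mixed_norm3_hoelder (a1 a2 b1 b2 c1 c2 : R) (h k : T1 * T2 * T3 -> R) :
  (0 < a1)%R -> (0 < a2)%R -> (a1^-1 + a2^-1 = 2^-1)%R ->
  (0 < b1)%R -> (0 < b2)%R -> (b1^-1 + b2^-1 = 2^-1)%R ->
  (0 < c1)%R -> (0 < c2)%R -> (c1^-1 + c2^-1 = 2^-1)%R ->
  measurable_fun setT h -> measurable_fun setT k ->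
  (forall z, 0 <= h z)%R -> (forall z, 0 <= k z)%R ->
  (\int[m1]_x \int[m2]_t \int[m3]_y
     ((h (x, t, y) * k (x, t, y)) `^ 2)%:E) `^ 2^-1 <=
  mixed_norm3 a1 b1 c1 h * mixed_norm3 a2 b2 c2 k.
Proof.
move=> a1_gt0 a2_gt0 a12 b1_gt0 b2_gt0 b12 c1_gt0 c2_gt0 c12 mh mk h0 k0.
pose A3 c (f : T1 * T2 * T3 -> R) (z : T1 * T2) : \bar R :=
  \int[m3]_y (f (z, y) `^ c)%:E.
pose A2 b c f (x : T1) : \bar R := \int[m2]_t (A3 c f (x, t)) `^ (b / c).
have mpow c (f : T1 * T2 * T3 -> R) : measurable_fun setT f ->
    measurable_fun setT (fun z => (f z `^ c)%:E).
  move=> mf; apply/measurable_EFinP.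
  exact: (measurableT_comp (measurable_powR c)).
have mA3 c f : measurable_fun setT f -> measurable_fun setT (A3 c f).
  move=> mf; apply: (measurable_fun_fubini_tonelli_F (fun z => (f z `^ c)%:E)).
    exact: mpow.
  by move=> z; rewrite lee_fin powR_ge0.
have A3_ge0 c f z : 0 <= A3 c f z.
  by apply: integral_ge0 => y _; rewrite lee_fin powR_ge0.
have mA2 b c f : measurable_fun setT f -> measurable_fun setT (A2 b c f).
  move=> mf; apply: (measurable_fun_fubini_tonelli_F
    (fun z => A3 c f z `^ (b / c))).
    exact: measurable_fun_poweR (mA3 _ _ mf).
  by move=> z; exact: poweR_ge0.
have A2_ge0 b c f x : 0 <= A2 b c f x.
  by apply: integral_ge0 => y _; exact: poweR_ge0.
have mhk : measurable_fun setT (fun z => (h z * k z)%R).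
  exact: measurable_funM.
have step3 z : A3 2%R (fun z => h z * k z)%R z <=
    A3 c1 h z `^ (2 / c1) * A3 c2 k z `^ (2 / c2).
  (* At the innermost layer the functions are [h] and [k] themselves, whence [r = s = 1]. *)
  have := @ge0_hoelder2 _ _ _ m3 (fun y => (h (z, y))%:E)
    (fun y => (k (z, y))%:E) c1 c2 1 1.
  rewrite !divr1; under eq_integral do rewrite -EFinM -powRM//.
  apply => //; try by move=> y; rewrite lee_fin.
  - by apply/measurable_EFinP; exact: (measurable_fun_pair2 _ mh).
  - by apply/measurable_EFinP; exact: (measurable_fun_pair2 _ mk).
have step2 x : \int[m2]_t A3 2%R (fun z => h z * k z)%R (x, t) <=
    A2 b1 c1 h x `^ (2 / b1) * A2 b2 c2 k x `^ (2 / b2).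
  apply: (@le_trans _ _ (\int[m2]_t
      (A3 c1 h (x, t) `^ (2 / c1) * A3 c2 k (x, t) `^ (2 / c2)))).
    apply: ge0_le_integral => //.
    - exact: (measurable_fun_pair2 _ (mA3 _ _ mhk)).
    - apply: emeasurable_funM; apply: measurable_fun_poweR;
        exact: (measurable_fun_pair2 _ (mA3 _ _ _)).
  apply: ge0_hoelder2 => //;
    exact: (measurable_fun_pair2 _ (mA3 _ _ _)).
have step1 : \int[m1]_x \int[m2]_t A3 2%R (fun z => h z * k z)%R (x, t) <=
    (\int[m1]_x A2 b1 c1 h x `^ (a1 / b1)) `^ (2 / a1) *
    (\int[m1]_x A2 b2 c2 k x `^ (a2 / b2)) `^ (2 / a2).
  apply: (@le_trans _ _ (\int[m1]_x
      (A2 b1 c1 h x `^ (2 / b1) * A2 b2 c2 k x `^ (2 / b2)))).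
    apply: ge0_le_integral => //.
    - by move=> x _; exact: integral_ge0.
    - exact: (measurable_fun_fubini_tonelli_F (A3 2%R _) (mA3 _ _ mhk)).
    - by apply: emeasurable_funM; apply: measurable_fun_poweR;
        exact: mA2.
  by apply: ge0_hoelder2 => //; exact: mA2.
rewrite /mixed_norm3 -/A3 -/A2.
(* The outer power [2^-1] on the left is matched by writing each [a^-1] on the right as [2 / a]
   times [2^-1]. *)
have half a : (2 / a * 2^-1 = a^-1 :> R)%R by rewrite mulrAC divff// mul1r.
rewrite -(half a1) -(half a2) [X in _ <= X * _]poweRrM [X in _ <= _ * X]poweRrM.
rewrite -poweRM ?poweR_ge0//.
apply: gt0_ler_poweR => //; rewrite in_itv/= leey andbT.
- do 3 (apply: integral_ge0 => ? _); by rewrite lee_fin powR_ge0.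
- by rewrite mule_ge0 ?poweR_ge0.
Qed.

End MixedHoelder.

(** * Directional terms controlled by the sector norms *)

Section SectorNorm.
Context {R : realType} {n : nat}.
Context (sigma epsT eps0 : R) (S : set 'cV[R]_n.+1) (m : 'cV[R]_n.+1 -> R).
Context (Oc : @sector_index R n.+1 -> 'M[R]_n.+1).
Local Open Scope ereal_scope.
Local Notation big := (2 / eps0)%R.
Local Notation small := (2 / (1 - eps0))%R.
Local Notation norm := (sector_norm sigma epsT eps0 S m Oc).

Lemma directional_norm_ge0 (a b c : R) (O : 'M[R]_n.+1) j I h :
  0 <= directional_norm a b c O j I h.
Proof. exact: poweR_ge0. Qed.

Lemma mixed_norm_ge0 (q r : R) I (h : R * 'cV[R]_n.+1 -> R[i]) :
  0 <= mixed_norm q r I h.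
Proof. exact: poweR_ge0. Qed.

Lemma sector_norm_ge_own (w w' : R) th I v (j : 'I_n.+1) :
  (0 <= w)%R -> (0 <= w')%R ->
  (freq epsT th `^ (- (sigma / 4)))%:E
      * directional_norm small big small (Oc th) j I v
    + w%:E * directional_norm small big big (Oc th) j I v <= norm w w' th I v.
Proof.
move=> w0 w'0; rewrite /sector_norm/= -[leLHS]adde0; apply: leeD; last first.
  apply: fsume_ge0 => O _; apply: sume_ge0 => i _.
  by rewrite adde_ge0// mule_ge0 ?directional_norm_ge0// lee_fin powR_ge0.
rewrite -[leLHS]add0e; apply: leeD; first by rewrite adde_ge0 ?mixed_norm_ge0.
rewrite (bigD1 j)//= leeDl// sume_ge0// => i _.
by rewrite adde_ge0// mule_ge0 ?directional_norm_ge0// lee_fin powR_ge0.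
Qed.

(** This serves [h_+]: the sum runs over the bases of all sectors, so it contains the basis of the
    other sector [th']. Finiteness of the range matters, because a sum with infinite support is [0]
    by convention. *)
Lemma sector_norm_ge_good (w w' : R) th th' I v (j : 'I_n.+1) :
  finite_set (Oc @` sectors S) ->
  (0 <= w)%R -> (0 <= w')%R -> sectors S th' ->
  j \in good_directions epsT m th (Oc th') ->
  (freq epsT th `^ ((sigma - 1) / 2))%:E
      * directional_norm big small small (Oc th') j I v
    + w'%:E * directional_norm big small big (Oc th') j I v
  <= norm w w' th I v.
Proof.
move=> finOc w0 w'0 Sth' jgood.
rewrite /sector_norm/= -[leLHS]add0e; apply: leeD.
  rewrite !adde_ge0 ?mixed_norm_ge0// sume_ge0// => i _.
  by rewrite adde_ge0// mule_ge0 ?directional_norm_ge0// lee_fin powR_ge0.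
rewrite (fsbigD1 (Oc th'))//=; last by exists th'.
have sum0 (O : 'M[R]_n.+1) (P : pred 'I_n.+1) : 0 <= \sum_(i | P i)
    ((freq epsT th `^ ((sigma - 1) / 2))%:E
        * directional_norm big small small O i I v
      + w'%:E * directional_norm big small big O i I v).
  rewrite sume_ge0// => i _.
  by rewrite adde_ge0// mule_ge0 ?directional_norm_ge0// lee_fin powR_ge0.
rewrite -[leLHS]adde0; apply: leeD; last first.
  by apply: fsume_ge0 => O _; exact: sum0.
by rewrite (bigD1 j)//= leeDl.
Qed.

End SectorNorm.

(** * Orthogonal matrices and the existence of a good direction *)

Section Orthogonal.
Context {R : realType} {n : nat}.
Implicit Types A O : 'M[R]_n.

Lemma orthogonal_mxT O : orthogonal_mx O -> orthogonal_mx O^T.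
Proof. by rewrite /orthogonal_mx trmxK => /mulmx1C. Qed.

Lemma orthogonal_mxM A O :
  orthogonal_mx A -> orthogonal_mx O -> orthogonal_mx (A *m O).
Proof.
by move=> AA OO; rewrite /orthogonal_mx trmx_mul -mulmxA (mulmxA A^T) AA mul1mx.
Qed.

Lemma orthogonal_tperm_mx (i j : 'I_n) : orthogonal_mx (tperm_mx i j : 'M[R]_n).
Proof.
by rewrite /orthogonal_mx tr_tperm_mx -perm_mxM perm.tperm2 perm_mx1.
Qed.

End Orthogonal.

(** Pigeonhole: the squared coordinates of the gradient in the orthonormal basis given by [O] add up
    to its squared norm, so they cannot all be smaller than that norm squared divided by the
    dimension. *)
Lemma good_direction_exists (R : realType) n (epsT : R) (m : 'cV[R]_n.+1 -> R)
    th (O : 'M[R]_n.+1) :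
  orthogonal_mx O -> exists j, j \in good_directions epsT m th O.
Proof.
move=> OO; set v := grad m (Defs.center epsT th).
apply/existsP; apply: contraT; rewrite negb_exists => /forallP none.
have dotE j : dot v (col j O) = (O^T *m v) j 0.
  by rewrite mxE; apply: eq_bigr => i _; rewrite !mxE mulrC.
have dv0 : 0 <= dot v v by apply: sumr_ge0 => i _; exact: sqr_ge0.
have small j : (O^T *m v) j 0 ^+ 2 < dot v v / n.+1%:R.
  have := none j; rewrite inE -ltNge -/v dotE => vj.
  rewrite -real_normK ?num_real// -(@sqr_sqrtr _ (dot v v))//.
  rewrite -(@sqr_sqrtr _ n.+1%:R)// -expr_div_n mulrC.
  by rewrite ltrXn2r// mulr_ge0// invr_ge0 sqrtr_ge0.
have : dot v v < dot v v.
  rewrite -{1}(dot_orthogonal v (orthogonal_mxT OO)).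
  have -> : dot v v = \sum_(i < n.+1) dot v v / n.+1%:R.
    by rewrite sumr_const card_ord -[RHS]mulr_natr divfK.
  rewrite /dot; apply: ltr_sum => [|i _]; last by rewrite -expr2 small.
  by apply/hasP; exists ord0; rewrite ?mem_index_enum.
by rewrite ltxx.
Qed.

(** * The bilinear L^2 bound in directional norms *)

Section Bilinear.
Context {R : realType} {n : nat}.
Local Notation leb := (@lebesgue_measure R).
Implicit Types h v : R * 'cV[R]_n.+1 -> R[i].
Local Open Scope ereal_scope.

Lemma measurable_normc_zero_ext (I : set R) h :
  is_interval I -> cmeasurable_fun (I `*` setT) h ->
  measurable_fun setT (fun z => Normc.normc (zero_ext I h z)).
Proof.
move=> iI [mre mim].
have mI : measurable (I `*` [set: 'cV[R]_n.+1]).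
  by apply: measurableX => //; exact: is_interval_measurable.
have -> : (fun z => Normc.normc (zero_ext I h z)) =
    (fun z => Normc.normc (h z)) \_ (I `*` setT).
  apply/funext => z; rewrite /zero_ext /patch; case: ifP => // _.
  exact: Normc.normc0.
apply: (measurable_restrictT _ mI).1.
have -> : (fun z => Normc.normc (h z)) =
    (fun z => (complex.Re (h z) ^+ 2 + complex.Im (h z) ^+ 2) `^ 2^-1)%R.
  by apply/funext => z; rewrite powR12_sqrt ?addr_ge0 ?sqr_ge0//; case: (h z).
apply: (@measurableT_comp _ _ _ _ _ _ (@powR R ^~ 2^-1%R)) => //.
by apply: measurable_funD; exact: measurable_funX.
Qed.

Lemma normc_ge0 (x : R[i]) : (0 <= Normc.normc x)%R.
Proof. by case: x => a b; exact: sqrtr_ge0. Qed.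

(** In the coordinates [x = A *m vcons (x1, x')], with [A] orthogonal, the directional norms are
    instances of [mixed_norm3]. It then remains to identify the iterated L^2 integral with the one
    over [I] and the whole space. *)
Lemma bilinear_directional (a1 a2 b1 b2 c1 c2 : R) (O : 'M[R]_n.+1) j I h k :
  (0 < a1)%R -> (0 < a2)%R -> (a1^-1 + a2^-1 = 2^-1)%R ->
  (0 < b1)%R -> (0 < b2)%R -> (b1^-1 + b2^-1 = 2^-1)%R ->
  (0 < c1)%R -> (0 < c2)%R -> (c1^-1 + c2^-1 = 2^-1)%R ->
  orthogonal_mx O -> is_interval I ->
  cmeasurable_fun (I `*` setT) h -> cmeasurable_fun (I `*` setT) k ->
  mixed_norm 2 2 I (fun z => h z * k z)%R <=
  directional_norm a1 b1 c1 O j setT (zero_ext I h) *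
  directional_norm a2 b2 c2 O j setT (zero_ext I k).
Proof.
move=> a1_gt0 a2_gt0 a12 b1_gt0 b2_gt0 b12 c1_gt0 c2_gt0 c12 OO iI mh mk.
set A := (O *m tperm_mx ord0 j)%R.
have AA : orthogonal_mx A.
  by apply: orthogonal_mxM => //; exact: orthogonal_tperm_mx.
pose N h (z : R * 'cV[R]_n.+1) := Normc.normc (zero_ext I h z).
pose P h (z : measurableTypeR R * measurableTypeR R * 'cV[R]_n) : R :=
  N h (z.1.2, A *m vcons (z.1.1, z.2))%R.
have mN f : cmeasurable_fun (I `*` setT) f -> measurable_fun setT (N f).
  exact: measurable_normc_zero_ext.
have mA : measurable_fun setT (fun x : 'cV[R]_n.+1 => A *m x)%R.
  have := measurable_affine A 0%R.
  by under eq_fun do rewrite addr0.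
have mcoord : measurable_fun setT
    (fun z : measurableTypeR R * measurableTypeR R * 'cV[R]_n =>
       (z.1.2 : R, A *m vcons (z.1.1 : R, z.2))%R).
  apply: measurable_fun_pair.
    exact: (measurableT_comp measurable_snd measurable_fst).
  apply: (measurableT_comp mA).
  apply: (measurableT_comp (@measurable_vcons R n)).
  apply: measurable_fun_pair; last exact: measurable_snd.
  exact: (measurableT_comp measurable_fst measurable_fst).
have mP f : cmeasurable_fun (I `*` setT) f -> measurable_fun setT (P f).
  by move=> mf; exact: (measurableT_comp (mN _ mf) mcoord).
have := @mixed_norm3_hoelder _ _ _ _ _ _ R leb leb (lebesgue_col n)
  a1 a2 b1 b2 c1 c2 (P h) (P k) a1_gt0 a2_gt0 a12 b1_gt0 b2_gt0 b12
  c1_gt0 c2_gt0 c12 (mP _ mh) (mP _ mk) (fun=> normc_ge0 _) (fun=> normc_ge0 _).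
(* The right-hand sides agree by definition; the rest of the proof is the equality of the two
   left-hand sides. *)
congr (_ <= _); rewrite /mixed_norm; congr (_ `^ _).
pose G (z : R * 'cV[R]_n.+1) : \bar R := ((N h z * N k z) `^ 2)%:E.
have mG : measurable_fun setT G.
  apply/measurable_EFinP.
  apply: (@measurableT_comp _ _ _ _ _ _ (@powR R ^~ 2%R)) => //.
  by apply: measurable_funM; exact: mN.
have G0 z : 0 <= G z by rewrite lee_fin powR_ge0.
transitivity (\int[leb]_x \int[leb]_t
    \int[lebesgue_col n]_y G (t, A *m vcons (x, y))%R); first by [].
have mGA : measurable_fun setT
    (fun z : measurableTypeR R * measurableTypeR R * 'cV[R]_n =>
    G (z.1.2 : R, A *m vcons (z.1.1 : R, z.2))%R).
  exact: (measurableT_comp mG mcoord).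
(* Exchanging [x_1] and [t] puts [x_1] next to [x'], so that for fixed [t] the two recombine into a
   point of the whole space and the rotation [A] can be removed. *)
rewrite (@fubini_tonelli _ _ _ _ R leb leb (fun z =>
  \int[lebesgue_col n]_y G (z.2, A *m vcons (z.1, y))%R)); first last.
- by move=> z; exact: integral_ge0.
- exact: (measurable_fun_fubini_tonelli_F _ mGA).
rewrite [RHS]integral_mkcond; apply: eq_integral => t _ /=.
have mGt : measurable_fun setT (fun x => G (t, x)).
  exact: (measurable_fun_pair2 t mG).
rewrite -(@ge0_integral_col _ _ (fun x => G (t, A *m x)%R))//; last first.
  exact: (measurableT_comp mGt mA).
rewrite (@ge0_integral_col_orthogonal _ _ A (fun x => G (t, x)))//.
have inI (x : 'cV[R]_n.+1) : ((t, x) \in I `*` setT) = (t \in I).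
  by apply/idP/idP; rewrite !inE => // -[].
rewrite patchE; case: ifPn => tI.
  (* For [t] in [I] the exponent in [mixed_norm 2 2] is [2 / 2 = 1]; for the other [t] the zero
     extensions vanish. *)
  rewrite divff// poweRe1; last first.
    by apply: integral_ge0 => x _; rewrite lee_fin powR_ge0.
  apply: eq_integral => x _.
  by rewrite /G /N /zero_ext /patch inI tI -Normc.normcM.
rewrite integral0_eq// => x _.
by rewrite /G /N /zero_ext /patch inI (negbTE tI) Normc.normc0 mul0r powR0.
Qed.

End Bilinear.

(** * Matching the weights and conclusion *)

Lemma le_weighted_mule (R : realType) (L D1 D2 X1 X2 : \bar R) (K w1 w2 : R) :
  (0 <= D1 -> 0 <= D2 -> (0 <= w1)%R -> (0 <= w2)%R -> (0 <= K)%R ->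
  (1 <= K * w1 * w2)%R -> L <= D1 * D2 -> w1%:E * D1 <= X1 ->
  w2%:E * D2 <= X2 ->
  L <= K%:E * (X1 * X2))%E.
Proof.
move=> D10 D20 w10 w20 K0 Kw LD wX1 wX2; apply: (le_trans LD).
(* The factor [K * w1 * w2], at least 1, is inserted and each weight is attached to its own norm. *)
apply: (@le_trans _ _ (K%:E * ((w1%:E * D1) * (w2%:E * D2)))%E); last first.
  by apply: lee_wpmul2l => //; apply: lee_pmul => //; exact: mule_ge0.
rewrite (muleACA w1%:E) !muleA -!EFinM -(muleA _ D1).
by apply: lee_pemull; rewrite ?mule_ge0// lee_fin.
Qed.

Lemma freq_ge1 (R : realType) d (epsT : R) (th : @sector_index R d) :
  0 <= epsT -> 1 <= freq epsT th.
Proof. by move=> epsT0; rewrite exprn_ege1// lerDl. Qed.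

Theorem lemma5p1 (R : realType) (eps : R) (eps_gt0 : 0 < eps) (eps_le1 : eps <= 1) :
  exists2 eps1 : R, 0 < eps1 &
  forall eps0 : R, 0 < eps0 -> eps0 < 2 ^- 100 -> eps0 < eps1 ->
  forall (n : nat) (sigma Cmax CL epsT : R) (m : 'cV[R]_n.+1 -> R)
    (S : set 'cV[R]_n.+1) (Oc : @sector_index R n.+1 -> 'M[R]_n.+1),
  2 <= sigma -> sigma < n.+1%:R ->
  symbol_of_order sigma Cmax CL m ->
  0 < epsT -> epsT <= 1 ->
  sector_directions epsT S ->
  adapted_basis_choice sigma Cmax epsT S m Oc ->
  exists2 C : R, 0 < C &
  forall I : set R, is_interval I ->
  forall h_p h_m : R * 'cV[R]_n.+1 -> R[i],
  cmeasurable_fun (I `*` setT) h_p -> cmeasurable_fun (I `*` setT) h_m ->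
  forall th_p th_m : @sector_index R n.+1, sectors S th_p -> sectors S th_m ->
  freq epsT th_m <= freq epsT th_p ->
  let N_p := freq epsT th_p in
  let N_m := freq epsT th_m in
  let X th h := Xnorm sigma epsT eps0 S m Oc th setT (zero_ext I h) in
  let Y th h := Ynorm sigma epsT eps0 S m Oc th setT (zero_ext I h) in
  let lhs := mixed_norm 2 2 I (fun z => h_p z * h_m z) in
  let K := C * N_p `^ eps * N_p `^ (- ((sigma - 1) / 2)) * N_m `^ (sigma / 4) in
  [/\ (lhs <= (K * N_m `^ ((2 * n.+1%:R - sigma - 2) / 4))%:E
                * (X th_p h_p * X th_m h_m))%E,
      (lhs <= K%:E * (Y th_p h_p * Y th_m h_m))%E,
      (lhs <= K%:E * (X th_p h_p * Y th_m h_m))%E &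
      (lhs <= K%:E * (Y th_p h_p * X th_m h_m))%E].
Proof.
(* The bound [eps0 < 1] makes [2 / (1 - eps0)] a positive exponent. *)
exists 1 => // eps0 eps0_gt0 _ eps0_lt1 n sigma Cmax CL epsT m S Oc _ _ _.
move=> epsT_gt0 _ _ [OcO finOc _]; exists 1 => // I iI hp hm mhp mhm.
move=> thp thm Sthp Sthm _ Np Nm X Y lhs K.
have Np1 : 1 <= Np by apply: freq_ge1; exact: ltW.
have Np0 : 0 < Np by exact: lt_le_trans Np1.
have Nm0 : 0 < Nm by apply: (lt_le_trans ltr01); apply: freq_ge1; exact: ltW.
have Npeps : 1 <= Np `^ eps.
  by rewrite -(powRr0 Np) ler_powR// ltW.
have powNK (x a : R) : 0 < x -> x `^ (- a) * x `^ a = 1.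
  by move=> x0; rewrite -powRD ?(gt_eqF x0) ?implybT// addNr powRr0.
have K_ge0 : 0 <= K by rewrite !mulr_ge0// powR_ge0.
(* The direction is good for the gradient at the centre of [thp], but is chosen among the basis
   vectors of [thm]. *)
have [j jgood] := @good_direction_exists R n epsT m thp (Oc thm) (OcO _ Sthm).
pose big : R := 2 / eps0; pose small : R := 2 / (1 - eps0).
have big_gt0 : 0 < big by rewrite divr_gt0.
have small_gt0 : 0 < small by rewrite divr_gt0// subr_gt0.
have bs : big^-1 + small^-1 = 2^-1.
  by rewrite !invf_div -mulrDl addrC subrK div1r.
have sb : small^-1 + big^-1 = 2^-1 by rewrite addrC.
(* The exponents in [x_1] and [t] are the same in all four bounds; only the exponent [c] in [x']
   varies. *)
pose Dp c := directional_norm big small c (Oc thm) j setT (zero_ext I hp).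
pose Dm c := directional_norm small big c (Oc thm) j setT (zero_ext I hm).
have lhsD c c' : 0 < c -> 0 < c' -> c^-1 + c'^-1 = 2^-1 ->
    (lhs <= Dp c * Dm c')%E.
  by move=> c0 c'0 cc'; apply: bilinear_directional => //; exact: OcO.
have wp_ge0 : 0 <= Np `^ ((sigma - 1) / 2) by exact: powR_ge0.
have Dp_ge0 c : (0 <= Dp c)%E by exact: directional_norm_ge0.
have Dm_ge0 c : (0 <= Dm c)%E by exact: directional_norm_ge0.
have own w w' th v : 0 <= w -> 0 <= w' ->
    ((freq epsT th `^ (- (sigma / 4)))%:E
        * directional_norm small big small (Oc th) j setT v
      <= sector_norm sigma epsT eps0 S m Oc w w' th setT v)%E /\
    (w%:E * directional_norm small big big (Oc th) j setT v
      <= sector_norm sigma epsT eps0 S m Oc w w' th setT v)%E.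
  move=> w0 w'0.
  have le := sector_norm_ge_own sigma epsT eps0 S m Oc th setT v j w0 w'0.
  by split; apply: le_trans le; [apply: leeDl|apply: leeDr];
    rewrite mule_ge0 ?directional_norm_ge0// lee_fin powR_ge0.
have good w w' v : 0 <= w -> 0 <= w' ->
    ((Np `^ ((sigma - 1) / 2))%:E
        * directional_norm big small small (Oc thm) j setT v
      <= sector_norm sigma epsT eps0 S m Oc w w' thp setT v)%E /\
    (w'%:E * directional_norm big small big (Oc thm) j setT v
      <= sector_norm sigma epsT eps0 S m Oc w w' thp setT v)%E.
  move=> w0 w'0.
  have le := sector_norm_ge_good sigma eps0 setT v finOc w0 w'0 Sthm jgood.
  by split; apply: le_trans le; [apply: leeDl|apply: leeDr];
    rewrite mule_ge0 ?directional_norm_ge0// lee_fin.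
have cancel2 (e a b a' b' : R) : a * a' = 1 -> b' * b = 1 ->
    1 * e * a * b * a' * b' = e.
  move=> aa bb; transitivity (e * (a * a') * (b' * b)); first by ring.
  by rewrite aa bb !mulr1.
have KYE : 1 <= K * Np `^ ((sigma - 1) / 2) * Nm `^ (- (sigma / 4)).
  by rewrite /K cancel2 ?powNK.
have KXE : 1 <= K * Nm `^ ((2 * n.+1%:R - sigma - 2) / 4) *
    Np `^ ((sigma - 1) / 2) * Nm `^ (- ((n.+1%:R - 1) / 2)).
  (* With [d = n.+1], the exponents [sigma / 4] and [(2 * d - sigma - 2) / 4] add up to
     [(d - 1) / 2], which offsets the weight special to [Xnorm]. *)
  have NmE : Nm `^ (sigma / 4) * Nm `^ ((2 * n.+1%:R - sigma - 2) / 4) =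
      Nm `^ ((n.+1%:R - 1) / 2).
    by rewrite -powRD ?(gt_eqF Nm0) ?implybT//; congr (_ `^ _); field.
  by rewrite /K -(mulrA _ (Nm `^ (sigma / 4))) NmE cancel2 ?powNK.
have wm_ge0 a : 0 <= Nm `^ a by exact: powR_ge0.
have KX_ge0 : 0 <= K * Nm `^ ((2 * n.+1%:R - sigma - 2) / 4) by exact: mulr_ge0.
split.
(* In the first three bounds [h_+] uses the good-direction term whose weight is common to both
   norms, and [h_-] the own-basis term of weight [w]: this is [Nm] to the power [-((d - 1) / 2)] in
   [Xnorm] and [-(sigma / 4)] in [Ynorm]. *)
- apply: (le_weighted_mule (Dp_ge0 _) (Dm_ge0 _) wp_ge0 (wm_ge0 _) KX_ge0 KXE
    (lhsD small big small_gt0 big_gt0 sb)).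
    by apply: (good _ _ _ _ _).1 => //; exact: powR_ge0.
  by apply: (own _ _ _ _ _ _).2 => //; exact: powR_ge0.
- apply: (le_weighted_mule (Dp_ge0 _) (Dm_ge0 _) wp_ge0 (wm_ge0 _) K_ge0 KYE
    (lhsD small big small_gt0 big_gt0 sb)).
    by apply: (good _ _ _ _ _).1 => //; exact: powR_ge0.
  by apply: (own _ _ _ _ _ _).2 => //; exact: powR_ge0.
- apply: (le_weighted_mule (Dp_ge0 _) (Dm_ge0 _) wp_ge0 (wm_ge0 _) K_ge0 KYE
    (lhsD small big small_gt0 big_gt0 sb)).
    by apply: (good _ _ _ _ _).1 => //; exact: powR_ge0.
  by apply: (own _ _ _ _ _ _).2 => //; exact: powR_ge0.
(* Here [h_-] is in [Xnorm] and no extra power of [Nm] is available, so it uses the own-basis term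
   of weight [Nm]^ (- (sigma /
   4))[. The exponent]big[in]x'[passes to]h_+[, where the weight]w'[of]Ynorm[is again]Np
   [^ ((sigma - 1) / 2)]. *)
- apply: (le_weighted_mule (Dp_ge0 _) (Dm_ge0 _) wp_ge0 (wm_ge0 _) K_ge0 KYE
    (lhsD big small big_gt0 small_gt0 bs)).
    by apply: (good _ _ _ _ _).2 => //; exact: powR_ge0.
  by apply: (own _ _ _ _ _ _).1 => //; exact: powR_ge0.
Qed.
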